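(* There exist positive absolute constants $C_1,C_2,C_3$ such that the following holds. Let $n,k,n_0$ be integers with $2\le k\le n$, $2\le n_0\le n$ and $\mathcal Z_{n,k,n_0}\neq\emptyset$. In the network sequence model with probability matrix $\boldsymbol\Theta_0$, the least squares estimator $\widehat{\boldsymbol\Theta}$ over $\mathcal Z_{n,k,n_0}$ satisfies $$\mathbb E\left[\frac{1}{n^{2}}\|\widehat{\boldsymbol\Theta}-\boldsymbol\Theta_0\|_F^2\right]\le \frac{C_1}{n^{2}}\|\boldsymbol\Theta_0-\boldsymbol\Theta_{*,n_0}\|_F^2+C_2\|\boldsymbol\Theta_0\|_\infty\left(\frac{\log k}{n}+\frac{k^2}{n^2}\right)+\frac{C_3\log(n/n_0)}{n_0}\left(\frac{\log k}{n}+\frac{k^2}{n^2}\right).$$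
   Context: Network sequence model: $\boldsymbol\Theta_0$ is a fixed symmetric $n\times n$ matrix with entries in $[0,1]$ and zero diagonal. One observes $\boldsymbol A'=(\boldsymbol A_{ij},\,1\le j<i\le n)$, independent Bernoulli variables with $\mathbb P(\boldsymbol A_{ij}=1)=(\boldsymbol\Theta_0)_{ij}$; $\mathbb E$ is expectation with respect to their distribution. $[m]=\{1,\dots,m\}$. $\mathcal Z_{n,k,n_0}$ is the set of maps $z:[n]\to[k]$ with $\min_{a\in[k]}|z^{-1}(a)|\ge n_0$. $\mathbb R^{k\times k}_{\rm sym}$ is the set of real symmetric $k\times k$ matrices. $\|\cdot\|_F$ is the Frobenius norm and $\|\cdot\|_\infty$ the entrywise supremum norm. Least squares estimator: let $L(\boldsymbol Q,z)=\sum_{1\le j<i\le n}(\boldsymbol A_{ij}-\boldsymbol Q_{z(i)z(j)})^2$ and let $(\widehat{\boldsymbol Q},\hat z)$ be a minimizer of $L(\boldsymbol Q,z)$ over $\boldsymbol Q\in\mathbb R^{k\times k}_{\rm sym}$, $z\in\mathcal Z_{n,k,n_0}$. Then $\widehat{\boldsymbol\Theta}$ is the symmetric $n\times n$ matrix with zero diagonal and $\widehat{\boldsymbol\Theta}_{ij}=\widehat{\boldsymbol Q}_{\hat z(i)\hat z(j)}$ for $i>j$. $\boldsymbol\Theta_{*,n_0}$ is a best Frobenius-norm approximation of $\boldsymbol\Theta_0$ in $\mathcal T_{n_0}[k]=\{\boldsymbol\Theta:\ \exists z\in\mathcal Z_{n,k,n_0},\ \boldsymbol Q\in\mathbb R^{k\times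 k}_{\rm sym}$ with $\boldsymbol\Theta_{ij}=\boldsymbol Q_{z(i)z(j)}$ for $i\ne j$ and $\boldsymbol\Theta_{ii}=0$ for all $i\}$. *)

(* Defs.v *)
From HB Require Import structures.
From mathcomp Require Import all_boot all_order all_algebra.
From mathcomp Require Import all_classical all_reals all_analysis.
Import Order.TTheory GRing.Theory Num.Theory.
Import numFieldNormedType.Exports.

Set Implicit Arguments.
Unset Strict Implicit.
Unset Printing Implicit Defensive.

Local Open Scope classical_set_scope.
Local Open Scope ring_scope.

(* The norm `|M| of the library on 'M[R]_(m, n) is the entrywise supremum
   norm; the Frobenius norm is not in the library. *)
Definition frobenius_norm (R : realType) (m n : nat) (M : 'M[R]_(m, n)) : R :=
  Num.sqrt (\sum_i \sum_j M i j ^+ 2).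

(* The pairs (i, j) with j < i. *)
Definition edge (n : nat) : predArgType := {p : 'I_n * 'I_n | (p.2 < p.1)%N}.

Definition network (n : nat) : predArgType := {ffun edge n -> bool}.

Definition edge_prob (R : realType) (n : nat) (Theta : 'M[R]_n) (e : edge n)
  : R := Theta (val e).1 (val e).2.

Definition probability_matrix (R : realType) (n : nat) (Theta : 'M[R]_n)
  : Prop :=
  [/\ Theta^T = Theta, forall i j, 0 <= Theta i j <= 1
    & forall i, Theta i i = 0].

Definition network_pmf (R : realType) (n : nat) (Theta : 'M[R]_n)
    (A : network n) : R :=
  \prod_(e : edge n) bernoulli_pmf (edge_prob Theta e) (A e).

Definition network_expectation (R : realType) (n : nat) (Theta : 'M[R]_n)
    (f : network n -> R) : R :=
  \sum_(A : network n) network_pmf Theta A * f A.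

(* Under network_pmf Theta the coordinates are independent, the one at e being
   Bernoulli (edge_prob Theta e). *)
Lemma network_pmf_indep (R : realType) (n : nat) (Theta : 'M[R]_n)
    (B : edge n -> {set bool}) :
  \sum_(A : network n | [forall e, A e \in B e]) network_pmf Theta A =
  \prod_(e : edge n) \sum_(b in B e) bernoulli_pmf (edge_prob Theta e) b.
Proof.
rewrite bigA_distr_big_dep; apply: eq_bigl => A.
by apply/forallP/familyP => AB e; apply: AB.
Qed.

Lemma network_pmf_sum1 (R : realType) (n : nat) (Theta : 'M[R]_n) :
  \sum_(A : network n) network_pmf Theta A = 1.
Proof.
transitivity (\sum_(A : network n | [forall e, A e \in [set: bool]%SET])
    network_pmf Theta A).
  by apply: eq_bigl => A; apply/esym/forallP => e; rewrite finset.in_setT.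
rewrite network_pmf_indep big1// => e _.
rewrite (eq_bigl predT); last by move=> b; rewrite finset.in_setT.
by rewrite big_bool/= /bernoulli_pmf addrC subrK.
Qed.

Definition label_map (n k : nat) : predArgType := {ffun 'I_n -> 'I_k}.

Definition balanced_maps (n k n0 : nat) : {set label_map n k} :=
  [set z : label_map n k |
    [forall a : 'I_k, (n0 <= #|[set i | z i == a]%SET|)%N]]%SET.

Definition least_squares_loss (R : realType) (n k : nat) (A : network n)
    (Q : 'M[R]_k) (z : label_map n k) : R :=
  \sum_(e : edge n) ((A e)%:R - Q (z (val e).1) (z (val e).2)) ^+ 2.

Definition least_squares_minimizer (R : realType) (n k n0 : nat)
    (A : network n) (Q : 'M[R]_k) (z : label_map n k) : Prop :=
  [/\ Q^T = Q, z \in balanced_maps n k n0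
    & forall (Q' : 'M[R]_k) (z' : label_map n k),
        Q'^T = Q' -> z' \in balanced_maps n k n0 ->
        least_squares_loss A Q z <= least_squares_loss A Q' z'].

(* Symmetric as soon as Q is. *)
Definition block_matrix (R : realType) (n k : nat) (Q : 'M[R]_k)
    (z : label_map n k) : 'M[R]_n :=
  \matrix_(i, j) if i == j then 0 else Q (z i) (z j).

Definition block_class (R : realType) (n k n0 : nat) : set 'M[R]_n :=
  [set Theta | exists z : label_map n k, exists Q : 'M[R]_k,
     [/\ z \in balanced_maps n k n0, Q^T = Q & Theta = block_matrix Q z]].

Definition best_block_approximation (R : realType) (n k n0 : nat)
    (Theta0 Thetas : 'M[R]_n) : Prop :=
  block_class k n0 Thetas /\
  forall Theta : 'M[R]_n, block_class k n0 Theta ->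
    frobenius_norm (Theta0 - Thetas) <= frobenius_norm (Theta0 - Theta).

(* Main.v *)
Require Import Defs.
From HB Require Import structures.
From mathcomp Require Import all_boot all_order all_algebra.
From mathcomp Require Import all_classical all_reals all_analysis.
From mathcomp Require Import ring lra zify.
Import Order.TTheory GRing.Theory Num.Theory.
Import numFieldNormedType.Exports.
Local Open Scope ring_scope.

Set Implicit Arguments.
Unset Strict Implicit.
Unset Printing Implicit Defensive.

(** Write [p] for the vector of edge probabilities, [w] for the centred
    observations, and [P z] for the projection that replaces a vector indexed by
    the edges by its averages over the blocks of the label map [z]. By Pythagoras
    the fitted vector is [P zhat] applied to the observations. Comparing its loss
    with the loss of the oracle vector [v], the projection of [p] on the blocks of
    a best approximation, gives
    [|fit - p|^2 <= 3 |v - p|^2 + 4 |P zhat w|^2 + 2 (2 <w, u> - |u|^2 / 4)],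
    where [u = P zhat p - v] (lemma [least_squares_basic_inequality]). Both noise
    terms depend on the data through [zhat], so they are bounded uniformly over the
    label maps. There are at most [k ^ n] of them, and a bound on exponential
    moments at the scale [8 r] costs [8 r (n ln k)] by the soft maximum
    [network_expectation_select].

    The linear term is easy: [u] has entries at most the maximal probability
    [rho], hence Bernstein's bound applies at the scale [r >= 4 rho]. The square
    [|P z w|^2] is the sum of [S^2 / m] over the blocks, for [S] the block sum of the
    noise and [m] the size of the block. A block sum has Poisson tails, so [S^2 / m]
    has exponential moments at scale [r] only while [|S| <= r m]. On this event
    the exponential of the square is dominated by a mixture of exponentials of
    linear forms, which independence turns into a factor 16 for each of the at most
    [k ^ 2] blocks (lemma [projected_noise_mgf]).

    The truncation holds for all balanced label maps at once with high
    probability, as soon as [r = 4 rho + 32 ln (n / n0) / n0]. The blocks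
    of a balanced map are sets of edges between two vertex sets of sizes [s, t >= n0];
    such a block has at least [n0 (s + t) / 8] edges, so the Chernoff bound for its
    density beats the number of pairs of vertex sets, whose logarithm is of order
    [(s + t) ln (n / n0)] (lemma [bounded_density_fail]). On the
    exceptional event the trivial bound [n ^ 2] on the loss suffices. This value of
    [r] is the source of the two rate terms. *)

(** * Exponential bounds *)

(** Squaring [1 - x / 2 <= expR (- (x / 2))] and inverting. The constant 2 is what makes
    the polynomial inequality hold up to [x = 1]. *)
Lemma expR_le_quadratic (R : realType) (x : R) :
  x <= 1 -> expR x <= 1 + x + 2 * x ^+ 2.
Proof.
move=> x1.
have h : 1 - x / 2 <= expR (- (x / 2)).
  by have := expR_ge1Dx (- (x / 2)).
have -> : expR x = (expR (- (x / 2)) ^+ 2)^-1.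
  rewrite -expRM_natl -expRN; congr expR; lra.
have e0 := expR_gt0 (- (x / 2)).
rewrite -div1r ler_pdivrMr ?exprn_gt0//.
have : (1 - x / 2) ^+ 2 <= expR (- (x / 2)) ^+ 2.
  by rewrite ler_pXn2r// ?nnegrE; lra.
have q0 : 0 <= 1 + x + 2 * x ^+ 2 by nra.
move=> /(ler_wpM2l q0); apply: le_trans.
rewrite -subr_ge0 (_ : _ - 1 = x ^+ 2 * ((1 - x) * (5 - 2 * x) / 4)); last by field.
by rewrite mulr_ge0 ?sqr_ge0//; nra.
Qed.

Lemma expR1_le4 (R : realType) : expR 1 <= 4 :> R.
Proof. by have := expR_le_quadratic (lexx (1 : R)); lra. Qed.

Lemma expR4_ge16 (R : realType) : 16 <= expR 4 :> R.
Proof.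
rewrite -[X in expR X]mulr1 expRM_natl (_ : 16 = 2 ^+ 4); last by rewrite -natrX.
by rewrite lerXn2r// ?nnegrE ?expR_ge0//; have := expR_ge1Dx (1 : R); lra.
Qed.

Lemma expR_half_le2 (R : realType) : expR (1 / 2) <= 2 :> R.
Proof. by have := @expR_le_quadratic R (1 / 2); lra. Qed.

Lemma ln_ge_half (R : realType) (x : R) : 2 <= x -> 1 / 2 <= ln x.
Proof.
move=> x2; rewrite -[_ / _]expRK ler_ln ?posrE ?expR_gt0//; last lra.
exact: le_trans (expR_half_le2 R) x2.
Qed.

(** * Expectation over the random network *)

Section network_expectation.
Variables (R : realType) (n : nat) (Theta : 'M[R]_n).
Implicit Types f g : network n -> R.
Local Notation Ex := (network_expectation Theta).

Lemma network_expectation_cst (c : R) : Ex (fun=> c) = c.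
Proof. by rewrite /network_expectation -mulr_suml network_pmf_sum1 mul1r. Qed.

Lemma network_expectationD f g : Ex (fun A => f A + g A) = Ex f + Ex g.
Proof.
by rewrite /network_expectation -big_split; apply: eq_bigr => A _; rewrite mulrDr.
Qed.

Lemma network_expectationZ (c : R) f : Ex (fun A => c * f A) = c * Ex f.
Proof.
by rewrite /network_expectation mulr_sumr; apply: eq_bigr => A _; rewrite mulrCA.
Qed.

Lemma network_expectation_sum (I : finType) (P : pred I)
    (F : I -> network n -> R) :
  Ex (fun A => \sum_(i | P i) F i A) = \sum_(i | P i) Ex (F i).
Proof.
rewrite /network_expectation exchange_big; apply: eq_bigr => A _.
by rewrite mulr_sumr.
Qed.

Lemma network_expectation_prod (g : edge n -> bool -> R) :
  Ex (fun A => \prod_e g e (A e)) =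
  \prod_e (edge_prob Theta e * g e true + (1 - edge_prob Theta e) * g e false).
Proof.
transitivity (\prod_e \sum_b bernoulli_pmf (edge_prob Theta e) b * g e b).
  rewrite bigA_distr_bigA; apply: eq_bigr => A _.
  by rewrite /network_pmf big_split.
by apply: eq_bigr => e _; rewrite big_bool.
Qed.

Hypothesis Theta01 : forall e, 0 <= edge_prob Theta e <= 1.

Lemma network_pmf_ge0 A : 0 <= network_pmf Theta A.
Proof.
apply: prodr_ge0 => e _; have := Theta01 e.
by rewrite /bernoulli_pmf; case: (A e); lra.
Qed.

Lemma le_network_expectation f g :
  (forall A, f A <= g A) -> Ex f <= Ex g.
Proof.
by move=> fg; apply: ler_sum => A _; rewrite ler_wpM2l// network_pmf_ge0.
Qed.

(** Only the means of the edges enter, through [1 + x <= expR x] applied to each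
    factor of the moment generating function. *)
Lemma network_expectation_expR (t : edge n -> R) :
  Ex (fun A => expR (\sum_e t e * (A e)%:R)) <=
  expR (\sum_e edge_prob Theta e * (expR (t e) - 1)).
Proof.
under [X in Ex X]funext => A do rewrite expR_sum.
rewrite (network_expectation_prod (fun e b => expR (t e * b%:R))) expR_sum.
apply: ler_prod => e _; have := Theta01 e; move: (edge_prob Theta e) => p p01.
rewrite mulr1 mulr0 expR0 mulr1; have et := expR_gt0 (t e).
apply/andP; split; first by nra.
by have := expR_ge1Dx (p * (expR (t e) - 1)); lra.
Qed.

(** The Bernstein regime: for parameters below 1 the noise has a sub-Gaussian
    moment generating function whose variance proxy is the bound on the edge
    probabilities. *)
Lemma network_noise_mgf (rho : R) (t : edge n -> R) :
  (forall e, edge_prob Theta e <= rho) -> (forall e, t e <= 1) ->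
  Ex (fun A => expR (\sum_e t e * ((A e)%:R - edge_prob Theta e))) <=
  expR (2 * rho * \sum_e t e ^+ 2).
Proof.
move=> prho t1.
under [X in Ex X]funext => A.
  have -> : \sum_e t e * ((A e)%:R - edge_prob Theta e) =
      - (\sum_e t e * edge_prob Theta e) + \sum_e t e * (A e)%:R.
    by rewrite -sumrN -big_split/=; apply: eq_bigr => e _; rewrite mulrBr addrC.
  rewrite expRD.
  over.
rewrite network_expectationZ.
apply: le_trans (ler_wpM2l (expR_ge0 _) (network_expectation_expR t)) _.
rewrite -expRD ler_expR -sumrN -big_split/= mulr_sumr ler_sum// => e _.
have := expR_le_quadratic (t1 e); have := prho e; have := Theta01 e.
move: (edge_prob Theta e) (expR (t e)) => p E /andP[p0 p1] pr ete.
have := sqr_ge0 (t e) => t2; nra.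
Qed.

(** A soft maximum: choosing the index after seeing the network costs only the
    logarithm of the number of indices. Since [x <= c + expR (x - c)], the
    bound follows by summing exponential moments. *)
Lemma network_expectation_select (I : finType) (P : pred I)
    (Y : I -> network n -> R) (sel : network n -> I) (G : pred (network n))
    (c : R) :
  0 <= c -> (forall A, P (sel A)) ->
  \sum_(i | P i) Ex (fun A => (G A)%:R * expR (Y i A)) <= expR c ->
  Ex (fun A => (G A)%:R * Y (sel A) A) <= c + 1.
Proof.
move=> c0 Psel hsum.
have le A : (G A)%:R * Y (sel A) A <=
    c + expR (- c) * \sum_(i | P i) (G A)%:R * expR (Y i A).
  case GA: (G A); last first.
    by rewrite mul0r big1 ?mulr0 ?addr0// => i _; rewrite mul0r.
  rewrite mul1r (bigD1 (sel A))//= mul1r mulrDr.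
  have s0 : 0 <= expR (- c) * \sum_(i | P i && (i != sel A)) true%:R * expR (Y i A).
    by rewrite mulr_ge0 ?expR_ge0 ?sumr_ge0// => i _; rewrite mul1r expR_ge0.
  have := expR_ge1Dx (Y (sel A) A - c); rewrite expRD mulrC; lra.
apply: le_trans (le_network_expectation le) _.
rewrite network_expectationD network_expectation_cst network_expectationZ.
rewrite network_expectation_sum lerD2l.
apply: le_trans (ler_wpM2l (expR_ge0 _) hsum) _.
by rewrite -expRD addNr expR0.
Qed.

End network_expectation.

(** * Block averages and least squares *)

Section block_average.
Variables (R : realType) (E B : finType) (b : E -> B).
Implicit Types (x y : E -> R) (q : B -> R).

Definition block_size (c : B) : R := #|[set e | b e == c]%SET|%:R.

Definition block_sum x (c : B) : R := \sum_(e | b e == c) x e.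

Definition block_average x (c : B) : R := block_sum x c / block_size c.

Lemma block_size_ge0 c : 0 <= block_size c.
Proof. exact: ler0n. Qed.

Lemma block_sum_cst (a : R) c : block_sum (fun=> a) c = block_size c * a.
Proof.
rewrite /block_sum /block_size sumr_const mulr_natl; congr (_ *+ _).
by apply: eq_card => e; rewrite inE.
Qed.

Lemma le_block_sum x y c :
  (forall e, x e <= y e) -> block_sum x c <= block_sum y c.
Proof. by move=> xy; apply: ler_sum => e _. Qed.

Lemma block_size0_sum x c : block_size c = 0 -> block_sum x c = 0.
Proof.
move=> /eqP; rewrite pnatr_eq0 cards_eq0 => /eqP b0.
rewrite /block_sum big1// => e ec.
by have := finset.in_set0 e; rewrite -b0 inE ec.
Qed.

Lemma block_averageM x c : block_average x c * block_size c = block_sum x c.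
Proof.
have [m0|m0] := eqVneq (block_size c) 0; last by rewrite divfK.
by rewrite m0 mulr0 block_size0_sum.
Qed.

Lemma block_average_ge0 x c : (forall e, 0 <= x e) -> 0 <= block_average x c.
Proof. by move=> x0; rewrite divr_ge0 ?block_size_ge0 ?sumr_ge0. Qed.

Lemma block_average_le x c (a : R) :
  0 <= a -> (forall e, x e <= a) -> block_average x c <= a.
Proof.
move=> a0 xa; have [m0|m0] := eqVneq (block_size c) 0.
  by rewrite /block_average m0 invr0 mulr0.
rewrite ler_pdivrMr ?lt0r ?m0 ?block_size_ge0//.
by rewrite mulrC -block_sum_cst le_block_sum.
Qed.

Lemma block_averageB x y c :
  block_average (fun e => x e - y e) c = block_average x c - block_average y c.
Proof. by rewrite /block_average /block_sum sumrB mulrBl. Qed.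

(** Orthogonality of the projection [x |-> block_average x \o b] onto the
    functions that are constant on the blocks. *)
Lemma block_average_orth x q :
  \sum_e x e * q (b e) = \sum_e block_average x (b e) * q (b e).
Proof.
rewrite !(partition_big b predT)//=; apply: eq_bigr => c _.
transitivity (block_sum x c * q c).
  by rewrite /block_sum mulr_suml; apply: eq_bigr => e /eqP ->.
rewrite -block_averageM mulrAC mulrC -block_sum_cst /block_sum.
by apply: eq_bigr => e /eqP ->.
Qed.

Lemma block_average_sqr x :
  \sum_e block_average x (b e) ^+ 2 = \sum_c block_sum x c ^+ 2 / block_size c.
Proof.
rewrite (partition_big b predT)//=; apply: eq_bigr => c _.
rewrite -block_averageM.
transitivity (block_size c * block_average x c ^+ 2).
  by rewrite -block_sum_cst; apply: eq_bigr => e /eqP ->.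
have [->|m0] := eqVneq (block_size c) 0; first by rewrite mulr0 invr0 mul0r mulr0.
by field.
Qed.

Lemma block_average_pythagoras x q :
  \sum_e (x e - q (b e)) ^+ 2 =
  \sum_e (x e - block_average x (b e)) ^+ 2 +
  \sum_e (block_average x (b e) - q (b e)) ^+ 2.
Proof.
have o := block_average_orth x (fun c => block_average x c - q c).
rewrite -big_split/=; apply/eqP; rewrite -subr_eq0 -sumrB.
have /eqP := o; rewrite -subr_eq0 -sumrB => o0.
rewrite (eq_bigr (fun e => 2 * (x e * (block_average x (b e) - q (b e)) -
   block_average x (b e) * (block_average x (b e) - q (b e))))).
  by rewrite -mulr_sumr mulf_eq0 o0 orbT.
by move=> e _; ring.
Qed.

Lemma block_average_best x q :
  \sum_e (x e - block_average x (b e)) ^+ 2 <= \sum_e (x e - q (b e)) ^+ 2.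
Proof.
by rewrite (block_average_pythagoras x q) lerDl sumr_ge0// => e _; apply: sqr_ge0.
Qed.

Lemma block_average_unique x q :
  \sum_e (x e - q (b e)) ^+ 2 <= \sum_e (x e - block_average x (b e)) ^+ 2 ->
  forall e, q (b e) = block_average x (b e).
Proof.
rewrite (block_average_pythagoras x q) gerDl => le0 e.
have : \sum_e (block_average x (b e) - q (b e)) ^+ 2 == 0.
  by rewrite eq_le le0 sumr_ge0// => i _; apply: sqr_ge0.
rewrite psumr_eq0; last by move=> i _; apply: sqr_ge0.
move=> /allP/(_ e (mem_index_enum _))/=.
by rewrite sqrf_eq0 subr_eq0 => /eqP ->.
Qed.

(** Expanding the comparison of losses leaves the inner product of the noise with the
    fitted vector minus [v]. This difference is the projected noise, whose inner
    product with the noise is its squared norm, plus the vector [u]. The quarter of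
    the squared norm of [u] that is subtracted in the last term, for the sake of its
    deviation bound, is repaid by half of the loss and half of the oracle loss: the
    projection of [p] is the best approximation of [p] on the blocks, so the squared
    norm of [u] is at most twice the sum of the two losses. *)
Lemma least_squares_basic_inequality (x p v : E -> R) :
  let u e := block_average p (b e) - v e in
  let w e := x e - p e in
  \sum_e (x e - block_average x (b e)) ^+ 2 <= \sum_e (x e - v e) ^+ 2 ->
  \sum_e (block_average x (b e) - p e) ^+ 2 <=
    3 * \sum_e (v e - p e) ^+ 2 +
    4 * \sum_e block_average w (b e) ^+ 2 +
    2 * \sum_e (2 * (u e * w e) - u e ^+ 2 / 4).
Proof.
move=> u w lsq; set ax := block_average x; set ap := block_average p.
have uw : \sum_e block_average w (b e) ^+ 2 = \sum_e w e * block_average w (b e).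
  by rewrite (block_average_orth w); apply: eq_bigr => e _; rewrite expr2.
have awE e : block_average w (b e) = ax (b e) - ap (b e).
  exact: block_averageB.
have expand : \sum_e (ax (b e) - p e) ^+ 2 <= \sum_e (v e - p e) ^+ 2
    + 2 * \sum_e block_average w (b e) ^+ 2 + 2 * \sum_e u e * w e.
  rewrite uw !mulr_sumr -!big_split/= -subr_ge0.
  move: lsq; rewrite -subr_ge0 -!sumrB => /le_trans; apply.
  rewrite le_eqVlt; apply/orP; left; apply/eqP; apply: eq_bigr => e _.
  by rewrite awE /u /w -/ax -/ap; ring.
have best := block_average_best p ax.
have uD : \sum_e u e ^+ 2 <=
    2 * \sum_e (p e - ap (b e)) ^+ 2 + 2 * \sum_e (v e - p e) ^+ 2.
  rewrite !mulr_sumr -big_split/= ler_sum// => e _.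
  by rewrite /u -/ap; have := sqr_ge0 (p e - ap (b e) - (v e - p e)); nra.
have sq : \sum_e (p e - ax (b e)) ^+ 2 = \sum_e (ax (b e) - p e) ^+ 2.
  by apply: eq_bigr => e _; rewrite -sqrrN opprB.
move: expand best uD; rewrite sq sumrB -mulr_sumr -mulr_suml -/ap; lra.
Qed.

End block_average.

(** * Exponential moments of the projected noise *)

Section quadratic_moment.
Variable R : realType.

(** The level [j] of [S ^+ 2 / (8 * r * m)] is reached where [`|S|] is the square root
    of [8 * r * m * j]; the Chernoff parameter is that root divided by [2 * r * m]. A
    level above [r * m / 8] is out of reach when [`|S| <= r * m]; it gets the
    parameter 0, so that all parameters are at most 1. *)
Definition peel_parameter (r m : R) (j : nat) : R :=
  if 8 * j%:R <= r * m then Num.sqrt (2 * j%:R / (r * m)) else 0.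

Lemma peel_parameter_ge0 r m j : 0 <= peel_parameter r m j.
Proof. by rewrite /peel_parameter; case: ifP => // _; apply: sqrtr_ge0. Qed.

Lemma peel_parameter_sqr r m j : 0 < r -> 0 <= m ->
  8 * j%:R <= r * m -> peel_parameter r m j ^+ 2 = 2 * j%:R / (r * m).
Proof.
move=> r0 m0 jrm; rewrite /peel_parameter jrm sqr_sqrtr//.
by rewrite divr_ge0 ?mulr_ge0// ltW.
Qed.

Lemma peel_parameter_le1 r m j : 0 < r -> 0 <= m -> peel_parameter r m j <= 1.
Proof.
move=> r0 m0; have [jrm|jrm] := boolP (8 * j%:R <= r * m); last first.
  by rewrite /peel_parameter (negbTE jrm).
rewrite -(@ler_pXn2r _ 2)// ?nnegrE ?peel_parameter_ge0//.
rewrite peel_parameter_sqr// expr1n.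
have [->|rm0] := eqVneq (r * m) 0; first by rewrite invr0 mulr0.
have rm : 0 < r * m by rewrite lt0r rm0 mulr_ge0// ltW.
by rewrite ler_pdivrMr//; have : 0 <= j%:R :> R by []; lra.
Qed.

Lemma peel_parameter_variance r m j : 0 < r -> 0 <= m ->
  r * m * peel_parameter r m j ^+ 2 <= 2 * j%:R.
Proof.
move=> r0 m0; have [jrm|jrm] := boolP (8 * j%:R <= r * m); last first.
  by rewrite /peel_parameter (negbTE jrm) expr0n mulr0 mulr_ge0.
rewrite peel_parameter_sqr//.
have [->|rm0] := eqVneq (r * m) 0; first by rewrite mul0r mulr_ge0.
by rewrite mulrC divfK.
Qed.

(** The exponential of a square is dominated by a mixture of exponentials of
    linear forms, one pair for each unit level of the exponent: at the level [j]
    of the exponent, the Chernoff factor of the matching sign is at least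
    [expR (4 * j)], so its product with the weight is at least [expR (j + 1)]. *)
Lemma expR_sqr_peel (r m S : R) (J : nat) :
  0 < r -> 0 <= m -> `|S| <= r * m -> r * m < J%:R ->
  expR (S ^+ 2 / (8 * r * m)) <=
  \sum_(k : 'I_J * bool)
     expR (1 - 3 * k.1%:R) * expR ((-1) ^+ k.2 * peel_parameter r m k.1 * S).
Proof.
move=> r0 m0 Srm rmJ; set y := _ / _.
have rm_ge0 : 0 <= r * m by rewrite mulr_ge0// ltW.
have y0 : 0 <= y by rewrite divr_ge0 ?sqr_ge0// -mulrA mulr_ge0.
have yS : 8 * y * (r * m) = S ^+ 2.
  have [rm0|rm0] := eqVneq (r * m) 0.
    move: Srm; rewrite rm0 normr_le0 => /eqP ->; ring.
  rewrite /y; field; apply/andP; split; apply: contra_neq rm0 => ->.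
  - by rewrite mulr0.
  - by rewrite mul0r.
have yrm : 8 * y <= r * m.
  have [rm0|rm0] := eqVneq (r * m) 0.
    by rewrite /y -mulrA rm0 mulr0 invr0 !mulr0.
  have rm : 0 < r * m by rewrite lt0r rm0.
  rewrite -(ler_pM2r rm) yS -expr2 -[leLHS]real_normK ?num_real//.
  by rewrite ler_pXn2r.
have /andP[jy yj] := truncn_itv y0; set j := Num.trunc y in jy yj.
have jJ : (j < J)%N by rewrite -(ltr_nat R); lra.
pose s := S < 0.
have sS : (-1) ^+ s * S = `|S|.
  rewrite /s; case: ltP => S0; first by rewrite expr1 mulN1r ltr0_norm.
  by rewrite expr0 mul1r ger0_norm.
rewrite (bigD1 (Ordinal jJ, s))//= ler_wpDr//.
  by apply: sumr_ge0 => k _; rewrite mulr_ge0// expR_ge0.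
rewrite -expRD ler_expR mulrAC sS.
have jrm : 8 * j%:R <= r * m by lra.
suff : 4 * j%:R <= `|S| * peel_parameter r m j by rewrite -natr1 in yj; lra.
rewrite -(@ler_pXn2r _ 2)// ?nnegrE ?mulr_ge0 ?peel_parameter_ge0//.
rewrite !exprMn peel_parameter_sqr// real_normK ?num_real// -yS.
have [rm0|rm0] := eqVneq (r * m) 0.
  have j0 : j%:R = 0 :> R.
    by apply/eqP; rewrite eq_le ler0n andbT; rewrite rm0 in jrm; lra.
  by rewrite j0 rm0 expr0n !mulr0 mul0r.
rewrite [leRHS](_ : _ = 16 * j%:R * y); last first.
  by field; apply/andP; split; apply: contra_neq rm0 => ->; rewrite ?mulr0 ?mul0r.
have : j%:R * j%:R <= j%:R * y :> R by rewrite ler_wpM2l.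
lra.
Qed.

Lemma peel_weight_sum (J : nat) :
  \sum_(k : 'I_J * bool) expR (1 - 3 * k.1%:R) * expR k.1%:R <= 16 :> R.
Proof.
rewrite -(pair_bigA _ (fun (j : 'I_J) (_ : bool) =>
  expR (1 - 3 * j%:R) * expR j%:R : R))/=.
have e2 : expR (-2) <= 1 / 2 :> R.
  by rewrite expRN div1r// lef_pV2 ?posrE ?expR_gt0//; have := expR_ge1Dx (2 : R); lra.
have geo : \sum_(j < J) (1 / 2) ^+ j = 2 - 2 * (1 / 2) ^+ J :> R.
  elim: J => [|J IH]; first by rewrite big_ord0 expr0; lra.
  by rewrite big_ord_recr/= IH exprS; lra.
apply: (@le_trans _ _ (\sum_(j < J) 8 * (1 / 2) ^+ j)); last first.
  have : 0 <= (1 / 2) ^+ J :> R by rewrite exprn_ge0//; lra.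
  by rewrite -mulr_sumr geo; lra.
apply: ler_sum => j _; rewrite big_bool/= -expRD.
have -> : 1 - 3 * j%:R + j%:R = 1 + j%:R * (-2) :> R by ring.
rewrite expRD expRM_natl.
have h1 : expR (-2) ^+ j <= (1 / 2) ^+ j :> R.
  by rewrite lerXn2r// ?nnegrE ?expR_ge0//; lra.
have := expR1_le4 R; have := expR_ge0 (1 : R); have := expR_ge0 (-2 : R).
move=> /(exprn_ge0 j); nra.
Qed.

Variables (n : nat) (Theta : 'M[R]_n) (B : finType) (b : edge n -> B).
Local Notation noise A := (fun e => (A e)%:R - edge_prob Theta e).

(** Up to constants, the truncated squared norm of the projected noise behaves like
    [r] times a chi-square variable with one degree of freedom for each block. Replacing
    the exponential of each square by a mixture of exponentials of linear forms
    turns the product over the blocks into a mixture of products over the edges,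
    to which independence applies. *)
Lemma projected_noise_mgf (rho r : R) :
  (forall e, 0 <= edge_prob Theta e <= 1) ->
  (forall e, edge_prob Theta e <= rho) -> 0 < r -> 4 * rho <= r ->
  network_expectation Theta (fun A =>
    [forall c, `|block_sum b (noise A) c| <= r * block_size R b c]%:R *
    expR ((8 * r)^-1 * \sum_e block_average b (noise A) (b e) ^+ 2))
  <= 16 ^+ #|B|.
Proof.
move=> p01 prho r0 rhor.
(* One number of levels that is enough for the blocks of all sizes. *)
pose J := (Num.trunc (r * #|{: edge n}|%:R)).+1.
have mJ c : r * block_size R b c < J%:R.
  have x0 : 0 <= r * #|{: edge n}|%:R by rewrite mulr_ge0// ltW.
  have /andP[_] := truncn_itv x0.
  by apply: le_lt_trans; rewrite ler_pM2l// ler_nat max_card.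
pose K : finType := ('I_J * bool)%type.
pose wt (k : K) : R := expR (1 - 3 * k.1%:R).
pose t c (k : K) : R := (-1) ^+ k.2 * peel_parameter r (block_size R b c) k.1.
have tS (A : network n) (f : {ffun B -> K}) :
    \prod_c (wt (f c) * expR (t c (f c) * block_sum b (noise A) c)) =
    (\prod_c wt (f c)) * expR (\sum_e t (b e) (f (b e)) * noise A e).
  rewrite big_split/=; congr (_ * _); rewrite -expR_sum; congr expR.
  rewrite [RHS](partition_big b predT)//=; apply: eq_bigr => c _.
  by rewrite /block_sum mulr_sumr; apply: eq_bigr => e /eqP ->.
pose mix (A : network n) := \sum_(f : {ffun B -> K})
  (\prod_c wt (f c)) * expR (\sum_e t (b e) (f (b e)) * noise A e).
have mixE A : mix A =
    \prod_c \sum_k wt k * expR (t c k * block_sum b (noise A) c).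
  by rewrite bigA_distr_bigA; apply: eq_bigr => f _; rewrite tS.
apply: (@le_trans _ _ (network_expectation Theta mix)).
  apply: le_network_expectation => // A.
  case: forallP => /= [good|_]; last first.
    rewrite mul0r; apply: sumr_ge0 => f _.
    by rewrite mulr_ge0 ?expR_ge0// prodr_ge0// => c _; apply: expR_ge0.
  rewrite mul1r mixE block_average_sqr mulr_sumr expR_sum.
  apply: ler_prod => c _; rewrite expR_ge0/=.
  rewrite mulrC -mulrA -invfM [_ * (8 * r)]mulrC.
  exact: expR_sqr_peel (block_size_ge0 R b c) (good c) (mJ c).
rewrite network_expectation_sum.
apply: (@le_trans _ _ (\sum_(f : {ffun B -> K}) \prod_c (wt (f c) * expR (f c).1%:R))).
  apply: ler_sum => f _; rewrite network_expectationZ big_split/=.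
  rewrite ler_wpM2l ?prodr_ge0//; first by move=> c _; apply: expR_ge0.
  apply: le_trans (network_noise_mgf p01 prho _) _ => [e|].
    rewrite /t; case: (f (b e)) => j [] /=; rewrite ?expr0 ?expr1 ?mul1r ?mulN1r.
      by have := @peel_parameter_ge0 r (block_size R b (b e)) j; lra.
    exact: peel_parameter_le1 r0 (block_size_ge0 R b _).
  rewrite -expR_sum ler_expR (partition_big b predT)//= mulr_sumr.
  apply: ler_sum => c _.
  have -> : \sum_(e | b e == c) t (b e) (f (b e)) ^+ 2 =
      block_size R b c * peel_parameter r (block_size R b c) (f c).1 ^+ 2.
    rewrite -block_sum_cst; apply: eq_bigr => e /eqP ->.
    by rewrite /t exprMn sqrr_sign mul1r.
  have := peel_parameter_variance (f c).1 r0 (block_size_ge0 R b c).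
  have := block_size_ge0 R b c.
  have := sqr_ge0 (peel_parameter r (block_size R b c) (f c).1).
  move: (block_size R b c) (_ ^+ 2) => m x x0 m0 v.
  have rho4 : rho <= r / 4 by rewrite ler_pdivlMr// mulrC.
  have := ler_wpM2r (mulr_ge0 m0 x0) rho4.
  lra.
rewrite -(bigA_distr_bigA (fun (c : B) (k : K) => wt k * expR k.1%:R)).
rewrite -prodr_const; apply: ler_prod => c _; apply/andP; split.
  by apply: sumr_ge0 => k _; rewrite mulr_ge0// expR_ge0.
exact: peel_weight_sum.
Qed.

(** The entries of [u] are at most [rho <= r / 4], so the form stays in the Bernstein
    regime, where its variance term is absorbed by the subtracted square. *)
Lemma linear_noise_mgf (rho r : R) (u : edge n -> R) :
  (forall e, 0 <= edge_prob Theta e <= 1) ->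
  (forall e, edge_prob Theta e <= rho) -> 0 < r -> 4 * rho <= r ->
  (forall e, u e <= rho) ->
  network_expectation Theta (fun A =>
    expR ((8 * r)^-1 * \sum_e (2 * (u e * noise A e) - u e ^+ 2 / 4))) <= 1.
Proof.
move=> p01 prho r0 rhor urho.
have s0 : 0 < (8 * r)^-1 by rewrite invr_gt0 mulr_gt0.
under [X in network_expectation _ X]funext => A.
  have -> : (8 * r)^-1 * \sum_e (2 * (u e * noise A e) - u e ^+ 2 / 4) =
      - ((8 * r)^-1 / 4 * \sum_e u e ^+ 2) +
      \sum_e (2 * (8 * r)^-1 * u e) * noise A e.
    rewrite !mulr_sumr -sumrN -big_split/=; apply: eq_bigr => e _.
    by move: (_^-1) => x; field.
  rewrite expRD.
  over.
rewrite network_expectationZ.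
have mgf := @network_noise_mgf R n Theta p01 rho (fun e => 2 * (8 * r)^-1 * u e) prho.
apply: le_trans (ler_wpM2l (expR_ge0 _) (mgf _)) _ => [e|].
  rewrite mulrAC ler_pdivrMr ?mulr_gt0//; have := urho e; lra.
rewrite -expRD -[leRHS]expR0 ler_expR.
under [X in _ + 2 * rho * X]eq_bigr => e _ do rewrite exprMn.
rewrite -mulr_sumr; set U := \sum_e _.
have U0 : 0 <= U by apply: sumr_ge0 => e _; apply: sqr_ge0.
have : rho * (8 * r)^-1 <= 1 / 32 by rewrite ler_pdivrMr ?mulr_gt0//; lra.
move: (8 * r)^-1 s0 => x x0 h.
have : rho * x * (x * U) <= 1 / 32 * (x * U) by rewrite ler_wpM2r// mulr_ge0// ltW.
rewrite exprMn; lra.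
Qed.

End quadratic_moment.

(** * Edges between sets of vertices *)

Lemma swap_pairK (T : Type) : involutive (fun p : T * T => (p.2, p.1)).
Proof. by case. Qed.

Lemma sum_edge (V : nmodType) (n : nat) (F : 'I_n -> 'I_n -> V) :
  \sum_i \sum_j F i j =
  \sum_i F i i + \sum_(e : edge n) (F (val e).1 (val e).2 + F (val e).2 (val e).1).
Proof.
have lower (G : 'I_n * 'I_n -> V) :
    \sum_(p : 'I_n * 'I_n | (p.2 < p.1)%N) G p = \sum_(e : edge n) G (val e).
  rewrite (reindex_omap (val : edge n -> _) insub); last first.
    by move=> p pP; rewrite insubT.
  by apply: eq_bigl => -[p pP] /=; rewrite insubT pP eqxx.
rewrite pair_bigA/= (bigID (fun p : 'I_n * 'I_n => p.1 == p.2))/=; congr (_ + _).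
  rewrite (eq_bigr (fun p => F p.1 p.1)); last by move=> p /eqP ->.
  rewrite -(pair_big_dep predT (fun i j => i == j) (fun i j => F i i))/=.
  by apply: eq_bigr => i _; rewrite (big_pred1 i)// => j; rewrite /= eq_sym.
rewrite (bigID (fun p : 'I_n * 'I_n => (p.2 < p.1)%N))/= big_split/=; congr (_ + _).
  rewrite -(lower (fun p => F p.1 p.2)); apply: eq_bigl => -[i j]/=.
  by rewrite andbC; case: ltngtP => // ij; rewrite -val_eqE/= gtn_eqF.
rewrite -(lower (fun p => F p.2 p.1)) (reindex_inj (inv_inj (@swap_pairK 'I_n)))/=.
apply: eq_bigl => -[i j]/=.
by rewrite -val_eqE/=; case: ltngtP.
Qed.

Section edges_between.
Variable n : nat.
Implicit Types S T : {set 'I_n}.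

Definition edges_between S T : {set edge n} :=
  [set e | ((val e).1 \in S) && ((val e).2 \in T)
        || ((val e).1 \in T) && ((val e).2 \in S)]%SET.

(** An edge accounts for at most two ordered pairs in the product of [S] and [T]; the
    pairs on the diagonal, at most [#|S|] many, come from no edge. *)
Lemma card_edges_between S T :
  (#|S| * #|T| <= #|S| + 2 * #|edges_between S T|)%N.
Proof.
have -> : (#|S| * #|T| = \sum_i \sum_j (i \in S) * (j \in T))%N.
  rewrite -!sum1_card big_distrl big_mkcond/=; apply: eq_bigr => i _.
  rewrite big_distrr/= big_mkcond/=.
  case: (i \in S); last by rewrite big1.
  by apply: eq_bigr => j _; case: (j \in T).
rewrite (@sum_edge nat) leq_add//.
  rewrite -sum1_card [leqRHS]big_mkcond/=.
  by apply: leq_sum => i _; case: (i \in S); case: (i \in T).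
rewrite -sum1_card big_distrr [leqRHS]big_mkcond/=. apply: leq_sum => e _.
rewrite inE; case: (_ \in S); case: (_ \in T); case: (_ \in S) => //=;
by case: (_ \in T).
Qed.

Lemma card_edges_between_ge n0 S T :
  (2 <= n0)%N -> (n0 <= #|S|)%N -> (n0 <= #|T|)%N ->
  (n0 * (#|S| + #|T|) <= 8 * #|edges_between S T|)%N.
Proof.
move=> n2 nS nT; have := card_edges_between S T.
by move: #|S| #|T| #|_| nS nT => s t m nS nT h; nia.
Qed.

Lemma sum_expr_card (R : comNzRingType) (x : R) :
  \sum_(S : {set 'I_n}) x ^+ #|S| = (1 + x) ^+ n.
Proof.
rewrite -[in RHS](card_ord n) -prodr_const addrC.
rewrite bigA_distr; apply: eq_bigr => S _.
rewrite (bigID (mem S))/= [X in _ * X]big1 ?mulr1; last by move=> i /negbTE ->.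
by rewrite (eq_bigr (fun=> x)) ?prodr_const// => i ->.
Qed.

(** Two of the four powers of [u ^+ #|S|] are at most [u ^+ (2 * n0)] in total. The
    other two are summed over all sets, to
    [(1 + u ^+ 2) ^+ n <= expR (n * u ^+ 2) = expR (n0 * u) <= 2 ^+ n0], and this is
    at most the inverse of [u ^+ n0]. *)
Lemma sum_large_sets (R : realType) (n0 : nat) (u : R) :
  0 <= u -> u <= 1 / 2 -> n%:R * u = n0%:R ->
  \sum_(S : {set 'I_n} | (n0 <= #|S|)%N) u ^+ (4 * #|S|) <= u ^+ n0.
Proof.
move=> u0 u2 nu.
apply: (@le_trans _ _ (u ^+ (2 * n0) * (1 + u ^+ 2) ^+ n)).
  rewrite -sum_expr_card mulr_sumr big_mkcond/=; apply: ler_sum => S _.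
  case: ifP => nS; last by rewrite mulr_ge0 ?exprn_ge0// sqr_ge0.
  rewrite -exprM -exprD ler_wiXn2l//; [lra|lia].
rewrite mul2n -addnn exprD -mulrA ler_piMr ?exprn_ge0//.
have h : (1 + u ^+ 2) ^+ n <= 2 ^+ n0.
  apply: (@le_trans _ _ (expR (u ^+ 2) ^+ n)).
    by rewrite lerXn2r// ?nnegrE ?expR_ge0 ?expR_ge1Dx// addr_ge0 ?sqr_ge0.
  rewrite -expRM_natl expr2 mulrA nu.
  apply: (@le_trans _ _ (expR (n0%:R * (1 / 2)))).
    by rewrite ler_expR ler_wpM2l.
  by rewrite expRM_natl lerXn2r// ?nnegrE ?expR_ge0 ?expR_half_le2.
apply: le_trans (ler_wpM2l (exprn_ge0 n0 u0) h) _.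
rewrite -exprMn exprn_ile1//; lra.
Qed.

(** The event that controls the block averages of all balanced label maps. It
    quantifies over pairs of vertex sets and not over label maps, so that the union
    bound only pays for the vertices of the two sets. *)
Definition bounded_density (R : realType) (n0 : nat) (r : R) (A : network n) : bool :=
  [forall S : {set 'I_n}, [forall T : {set 'I_n},
    (n0 <= #|S|)%N && (n0 <= #|T|)%N ==>
    (\sum_(e in edges_between S T) (A e)%:R <= r * #|edges_between S T|%:R)]].

(** Chernoff with parameter 1 for each pair of sets. The excess density
    [32 * ln (n / n0) / n0] beats the entropy of the pairs, because a pair has at
    least [n0 * (#|S| + #|T|) / 8] edges. *)
Lemma bounded_density_fail (R : realType) (Theta : 'M[R]_n) (n0 : nat)
    (rho r u : R) :
  (forall e, 0 <= edge_prob Theta e <= 1) ->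
  (forall e, edge_prob Theta e <= rho) ->
  (2 <= n0)%N -> 0 < u -> u <= 1 / 2 -> n%:R * u = n0%:R ->
  r = 4 * rho - 32 * ln u / n0%:R -> 0 <= rho ->
  network_expectation Theta (fun A => (~~ bounded_density n0 r A)%:R)
  <= u ^+ (2 * n0).
Proof.
move=> p01 prho n2 u0 u2 nu rE rho0.
pose big (S : {set 'I_n}) := (n0 <= #|S|)%N.
pose F (p : {set 'I_n} * {set 'I_n}) (A : network n) : R :=
  expR (- (r * #|edges_between p.1 p.2|%:R)) *
  expR (\sum_e (e \in edges_between p.1 p.2)%:R * (A e)%:R).
apply: (@le_trans _ _ (network_expectation Theta
    (fun A => \sum_(p | big p.1 && big p.2) F p A))).
  apply: le_network_expectation => // A.
  have F0 p : 0 <= F p A by rewrite mulr_ge0 ?expR_ge0.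
  case: (boolP (bounded_density n0 r A)) => [_|]; first exact: sumr_ge0.
  rewrite negb_forall => /existsP[S]; rewrite negb_forall => /existsP[T].
  rewrite negb_imply -ltNge => /andP[bST dens].
  rewrite (bigD1 (S, T))//= ler_wpDr ?sumr_ge0//.
  rewrite /F -expRD -[leLHS]expR0 ler_expR addrC subr_ge0 ltW//=.
  apply: lt_le_trans dens _; rewrite big_mkcond/= ler_sum// => e _.
  by case: ifP => _; rewrite ?mul1r ?mul0r.
rewrite network_expectation_sum.
apply: (@le_trans _ _ (\sum_(p : {set 'I_n} * {set 'I_n} | big p.1 && big p.2)
    u ^+ (4 * #|p.1|) * u ^+ (4 * #|p.2|))).
  apply: ler_sum => -[S T] /= /andP[bS bT]; rewrite network_expectationZ /=.
  apply: le_trans (ler_wpM2l (expR_ge0 _) (network_expectation_expR p01 _)) _.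
  rewrite -[u in leRHS](@lnK R u) ?posrE// -!expRM_natl -!expRD ler_expR.
  set m := #|_|.
  have : \sum_e edge_prob Theta e * (expR (e \in edges_between S T)%:R - 1)
      <= 3 * rho * m%:R.
    rewrite /m -sum1_card natr_sum mulr_sumr [leRHS]big_mkcond/= ler_sum// => e _.
    case: ifP => _; last by rewrite expR0 subrr mulr0.
    by have := expR1_le4 R; have := prho e; have /andP[] := p01 e; nra.
  have m0 : 0 <= rho * m%:R by rewrite mulr_ge0.
  have n0p : 0 < n0%:R :> R by rewrite ltr0n; lia.
  have L0 : 0 <= - ln u / n0%:R by rewrite divr_ge0// oppr_ge0 ln_le0//; lra.
  have : n0%:R * (#|S|%:R + #|T|%:R) <= 8 * m%:R :> R.
    by rewrite -natrD -!natrM ler_nat card_edges_between_ge.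
  move/(ler_wpM2l L0); rewrite mulrA divfK ?gt_eqF//.
  rewrite rE !natrM; move: #|S|%:R #|T|%:R m%:R m0 => s t m' m0.
  rewrite -[32 * ln u / _]mulrA !mulNr; move: (ln u / _) (\sum_e _) => l X.
  lra.
rewrite -(pair_big big big (fun S T => u ^+ (4 * #|S|) * u ^+ (4 * #|T|)))/=.
under eq_bigr => S _ do rewrite -mulr_sumr.
rewrite -mulr_suml mul2n -addnn exprD.
have s0 : 0 <= \sum_(S : {set 'I_n} | big S) u ^+ (4 * #|S|).
  by apply: sumr_ge0 => S _; rewrite exprn_ge0 ?ltW.
by apply: ler_pM => //; apply: sum_large_sets => //; apply: ltW.
Qed.

End edges_between.

(** * Blocks of a label map *)

Section label_map_blocks.
Variables (R : realType) (n k : nat).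
Implicit Types (z : label_map n k) (Q : 'M[R]_k).

(** An unordered pair of labels, encoded by its sorted representative. *)
Definition block_key (a b : 'I_k) : 'I_k * 'I_k :=
  if (a <= b)%N then (a, b) else (b, a).

Definition block_of z (e : edge n) : 'I_k * 'I_k :=
  block_key (z (val e).1) (z (val e).2).

Lemma block_key_value Q (a b : 'I_k) :
  Q^T = Q -> Q (block_key a b).1 (block_key a b).2 = Q a b.
Proof. by move=> Qs; rewrite /block_key; case: ifP => //= _; rewrite -[in LHS]Qs mxE. Qed.

Lemma block_key_sym (a b : 'I_k) : block_key a b = block_key b a.
Proof.
rewrite /block_key; case: (leqP a b) => ab; case: (leqP b a) => ba //.
  by have -> : a = b by apply/val_inj/eqP; rewrite eqn_leq ab ba.
by have := ltn_trans ab ba; rewrite ltnn.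
Qed.

Lemma block_of_edges z (a b : 'I_k) : (a <= b)%N ->
  [set e | block_of z e == (a, b)]%SET =
  edges_between [set i | z i == a]%SET [set i | z i == b]%SET.
Proof.
move=> ab; apply/finset.setP => e; rewrite !inE /block_of /block_key.
move: (z _) (z _) => x y; apply/eqP/orP.
- by case: ifP => _ [-> ->]; rewrite !eqxx; [left|right].
- case=> /andP[/eqP -> /eqP ->]; first by rewrite ab.
  case: ifP => // ba.
  by have -> : a = b by apply/val_inj/eqP; rewrite eqn_leq ab ba.
Qed.

Lemma block_of_unsorted z (c : 'I_k * 'I_k) :
  (c.2 < c.1)%N -> [set e | block_of z e == c]%SET = finset.set0.
Proof.
move=> ba; apply/finset.setP => e; rewrite !inE /block_of /block_key.
apply/negP; case: ifP => xy /eqP ce; rewrite -ce /= in ba.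
  by rewrite ltnNge xy in ba.
by rewrite (ltnW ba) in xy.
Qed.

Variable n0 : nat.

(** The balance of the label map makes each block a set of edges between large vertex
    sets, so the density bound controls all block averages at once. *)
Lemma bounded_density_block (r : R) (A : network n) z c :
  z \in balanced_maps n k n0 -> bounded_density n0 r A ->
  block_sum (block_of z) (fun e => (A e)%:R) c <= r * block_size R (block_of z) c.
Proof.
rewrite inE => /forallP zbal dens; case: c => a b.
rewrite /block_size /block_sum.
rewrite (eq_bigl (mem [set e | block_of z e == (a, b)]%SET)); last first.
  by move=> e; rewrite !inE.
have [ab|ba] := leqP a b; last first.
  by rewrite block_of_unsorted// big_set0 cards0 mulr0.
rewrite block_of_edges//.
move: dens => /forallP/(_ [set i | z i == a]%SET)/forallP/(_ [set i | z i == b]%SET).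
by rewrite !zbal.
Qed.

Lemma balanced_maps_leq z : z \in balanced_maps n k n0 -> (k * n0 <= n)%N.
Proof.
rewrite inE => /forallP zbal.
have -> : n = (\sum_(a : 'I_k) #|[set i | z i == a]%SET|)%N.
  rewrite -[LHS]card_ord -sum1_card (partition_big z predT)//=.
  apply: eq_bigr => a _; rewrite -sum1_card; apply: eq_bigl => i.
  by rewrite inE.
rewrite -[X in (X * _)%N]card_ord -sum_nat_const.
by apply: leq_sum => a _; apply: zbal.
Qed.

Variable A : network n.
Local Notation obs := (fun e => (A e)%:R : R).

Definition block_value_matrix (q : 'I_k * 'I_k -> R) : 'M[R]_k :=
  \matrix_(a, b) q (block_key a b).

Lemma block_value_matrix_sym q : (block_value_matrix q)^T = block_value_matrix q.
Proof. by apply/matrixP => a b; rewrite !mxE block_key_sym. Qed.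

Lemma least_squares_loss_block_value z q :
  least_squares_loss A (block_value_matrix q) z =
  \sum_e (obs e - q (block_of z e)) ^+ 2.
Proof. by apply: eq_bigr => e _; rewrite mxE. Qed.

(** By Pythagoras, changing the averages over the blocks to other values costs the
    squared distance between the two, and a minimizer cannot afford it. *)
Lemma least_squares_fit Q z : least_squares_minimizer n0 A Q z ->
  forall e, Q (z (val e).1) (z (val e).2) =
            block_average (block_of z) obs (block_of z e).
Proof.
move=> [Qsym zbal Qmin].
have lossE : least_squares_loss A Q z =
    \sum_e (obs e - Q (block_of z e).1 (block_of z e).2) ^+ 2.
  by apply: eq_bigr => e _; rewrite block_key_value.
have := Qmin _ _ (block_value_matrix_sym (block_average (block_of z) obs)) zbal.
rewrite lossE least_squares_loss_block_value => /(@block_average_unique R _ _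
  (block_of z) obs (fun c => Q c.1 c.2)) fit e.
by rewrite -fit block_key_value.
Qed.

Lemma least_squares_le Q z (z' : label_map n k) (q : 'I_k * 'I_k -> R) :
  least_squares_minimizer n0 A Q z -> z' \in balanced_maps n k n0 ->
  \sum_e (obs e - block_average (block_of z) obs (block_of z e)) ^+ 2 <=
  \sum_e (obs e - q (block_of z' e)) ^+ 2.
Proof.
move=> QzP z'bal; have fit := least_squares_fit QzP; case: QzP => _ _ Qmin.
rewrite -(least_squares_loss_block_value z' q).
apply: le_trans (Qmin _ _ (block_value_matrix_sym q) z'bal).
by rewrite le_eqVlt; apply/orP; left; apply/eqP/eq_bigr => e _; rewrite fit.
Qed.

End label_map_blocks.

Lemma frobenius_norm_sqr (R : realType) (n : nat) (M : 'M[R]_n) :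
  M^T = M -> (forall i, M i i = 0) ->
  frobenius_norm M ^+ 2 = 2 * \sum_(e : edge n) M (val e).1 (val e).2 ^+ 2.
Proof.
move=> Msym M0; rewrite sqr_sqrtr; last first.
  by apply: sumr_ge0 => i _; apply: sumr_ge0 => j _; apply: sqr_ge0.
rewrite (sum_edge (fun i j => M i j ^+ 2)) big1 ?add0r; last first.
  by move=> i _; rewrite M0 expr0n.
rewrite mulr_sumr; apply: eq_bigr => e _.
have -> : M (val e).2 (val e).1 = M (val e).1 (val e).2 by rewrite -[in LHS]Msym mxE.
by rewrite mulr2n mulrDl mul1r.
Qed.

Lemma block_matrix_sym (R : realType) (n k : nat) (Q : 'M[R]_k) (z : label_map n k) :
  Q^T = Q -> (block_matrix Q z)^T = block_matrix Q z.
Proof.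
by move=> Qs; apply/matrixP => i j; rewrite !mxE eq_sym -[in LHS]Qs mxE.
Qed.

Lemma block_matrix_edge (R : realType) (n k : nat) (Q : 'M[R]_k) (z : label_map n k)
    (e : edge n) :
  block_matrix Q z (val e).1 (val e).2 = Q (z (val e).1) (z (val e).2).
Proof. by rewrite mxE -val_eqE/= gtn_eqF// (valP e). Qed.

Lemma le_mx_norm (R : realType) (m n : nat) (M : 'M[R]_(m, n)) i j :
  M i j <= `|M|.
Proof.
apply: le_trans (ler_norm _) _; rewrite [leRHS]mx_normrE.
exact: (le_bigmax _ (fun p : 'I_m * 'I_n => `|M p.1 p.2|) (i, j)).
Qed.

Lemma card_edge (n : nat) : (#|{: edge n}| <= n ^ 2)%N.
Proof.
by rewrite -[n in leqRHS]card_ord -mulnn -card_prod; apply: (leq_card val val_inj).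
Qed.

(** * The oracle inequality *)

Section oracle_inequality.
Variables (R : realType) (n k n0 : nat) (Theta : 'M[R]_n) (rho r : R).
Local Notation p := (edge_prob Theta).
Local Notation Ex := (network_expectation Theta).
Hypothesis p01 : forall e, 0 <= p e <= 1.
Hypothesis prho : forall e, p e <= rho.
Hypothesis rho0 : 0 <= rho.
Hypothesis r0 : 0 < r.
Hypothesis rhor : 4 * rho <= r.
Implicit Type z : label_map n k.

Local Notation noise A := (fun e : edge n => (A e)%:R - p e : R).

Lemma bounded_density_noise (A : network n) z c :
  z \in balanced_maps n k n0 -> bounded_density n0 r A ->
  `|block_sum (block_of z) (noise A) c| <= r * block_size R (block_of z) c.
Proof.
move=> zbal dens; have Ar := bounded_density_block c zbal dens.
have A0 : 0 <= block_sum (block_of z) (fun e => (A e)%:R : R) c.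
  by apply: sumr_ge0 => e _; apply: ler0n.
have p0 : 0 <= block_sum (block_of z) p c.
  by apply: sumr_ge0 => e _; case/andP: (p01 e).
have pr : block_sum (block_of z) p c <= r * block_size R (block_of z) c.
  rewrite mulrC -block_sum_cst; apply: le_block_sum => e /=.
  by have := prho e; have := rho0; have := rhor; lra.
have -> : block_sum (block_of z) (noise A) c =
    block_sum (block_of z) (fun e => (A e)%:R) c - block_sum (block_of z) p c.
  by rewrite /block_sum sumrB.
by rewrite ler_norml; apply/andP; split; lra.
Qed.

Variables (z0 : label_map n k) (Qhat : network n -> 'M[R]_k)
  (zhat : network n -> label_map n k).
Hypothesis z0bal : z0 \in balanced_maps n k n0.
Hypothesis hatP : forall A, least_squares_minimizer n0 A (Qhat A) (zhat A).

Local Notation loss A := (\sum_(e : edge n)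
  (Qhat A (zhat A (val e).1) (zhat A (val e).2) - p e) ^+ 2).
Local Notation oracle e := (block_average (block_of z0) p (block_of z0 e)).
Local Notation bias z e := (block_average (block_of z) p (block_of z e) - oracle e).
Local Notation quadratic z A :=
  (\sum_e block_average (block_of z) (noise A) (block_of z e) ^+ 2).
Local Notation linear z A :=
  (\sum_e (2 * (bias z e * noise A e) - bias z e ^+ 2 / 4)).

Lemma loss_le_card A : loss A <= n%:R ^+ 2.
Proof.
apply: (@le_trans _ _ (\sum_(e : edge n) 1)).
  apply: ler_sum => e _; rewrite (least_squares_fit (hatP A)).
  have a0 : 0 <= block_average (block_of (zhat A)) (fun e => (A e)%:R : R)
      (block_of (zhat A) e) by apply: block_average_ge0.
  have a1 : block_average (block_of (zhat A)) (fun e => (A e)%:R : R)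
      (block_of (zhat A) e) <= 1.
    by apply: block_average_le => // i; case: (A i).
  case/andP: (p01 e) => p0 p1.
  by rewrite -real_normK ?num_real// exprn_ile1// ler_norml; lra.
by rewrite sumr_const -natrX ler_nat card_edge.
Qed.

Lemma loss_le A : loss A <=
  3 * \sum_e (oracle e - p e) ^+ 2 + 4 * quadratic (zhat A) A + 2 * linear (zhat A) A.
Proof.
under eq_bigr => e _ do rewrite (least_squares_fit (hatP A)).
apply: least_squares_basic_inequality.
exact: (least_squares_le (block_average (block_of z0) p) (hatP A) z0bal).
Qed.

(** On the event of bounded density both noise terms have exponential moments at the scale
    [8 * r], uniformly in the label map, and the logarithm of the number of label
    maps is at most [n * ln k]. Outside that event, the loss is at most [n ^+ 2]. *)
Lemma expected_loss_le : (0 < k)%N ->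
  Ex (fun A => loss A) <=
  3 * \sum_e (oracle e - p e) ^+ 2 +
  48 * r * (n%:R * ln k%:R + 4 * k%:R ^+ 2 + 1) +
  n%:R ^+ 2 * Ex (fun A => (~~ bounded_density n0 r A)%:R).
Proof.
move=> k0; set c := n%:R * ln k%:R + _.
have k1 : 1 <= k%:R :> R by rewrite ler1n.
have c0 : 0 <= c by rewrite addr_ge0 ?mulr_ge0 ?ln_ge0 ?sqr_ge0.
pose G (A : network n) := bounded_density n0 r A.
pose Z z := z \in balanced_maps n k n0.
have Zhat A : Z (zhat A) by case: (hatP A).
have s0 : 0 < 8 * r by rewrite mulr_gt0.
have cardZ (M : R) : 0 <= M -> \sum_(z | Z z) M <= expR (n%:R * ln k%:R) * M.
  move=> M0; rewrite sumr_const -[leLHS]mulr_natl ler_wpM2r//.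
  rewrite expRM_natl lnK ?posrE ?ltr0n// -natrX ler_nat.
  by apply: leq_trans (max_card _) _; rewrite card_ffun !card_ord.
(* The [k * k] factors 16 are the term [4 * k ^+ 2] of [c], as [16 <= expR 4]. *)
have quad : Ex (fun A => (G A)%:R * ((8 * r)^-1 * quadratic (zhat A) A)) <= c + 1.
  apply: (network_expectation_select p01 (P := Z)
    (Y := fun z A => (8 * r)^-1 * quadratic z A) c0 Zhat).
  apply: (@le_trans _ _ (\sum_(z | Z z) 16 ^+ (k * k))).
    apply: ler_sum => z zbal.
    have := projected_noise_mgf (block_of z) p01 prho r0 rhor.
    rewrite card_prod card_ord; apply: le_trans; apply: le_network_expectation => // A.
    rewrite ler_wpM2r ?expR_ge0// ler_nat.
    case GA: (G A) => //; rewrite lt0b; apply/forallP => b.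
    exact: bounded_density_noise.
  apply: le_trans (cardZ _ _) _; first exact: exprn_ge0.
  rewrite expRD ler_wpM2l ?expR_ge0//.
  rewrite mulrC expr2 -natrM expRM_natl lerXn2r// ?nnegrE ?expR_ge0//.
  exact: expR4_ge16.
have lin : Ex (fun A => (G A)%:R * ((8 * r)^-1 * linear (zhat A) A)) <= c + 1.
  apply: (network_expectation_select p01 (P := Z)
    (Y := fun z A => (8 * r)^-1 * linear z A) c0 Zhat).
  apply: (@le_trans _ _ (\sum_(z | Z z) 1)).
    apply: ler_sum => z zbal.
    have biasr e : bias z e <= rho.
      have p0 i : 0 <= p i by case/andP: (p01 i).
      have := @block_average_le R _ _ (block_of z) p (block_of z e) rho rho0 prho.
      have := @block_average_ge0 R _ _ (block_of z0) p (block_of z0 e) p0.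
      lra.
    have := linear_noise_mgf p01 prho r0 rhor biasr.
    apply: le_trans; apply: le_network_expectation => // A.
    by rewrite ler_piMl ?expR_ge0// lern1 leq_b1.
  apply: le_trans (cardZ _ _) _ => //.
  by rewrite mulr1 ler_expR lerDl mulr_ge0 ?sqr_ge0.
set D := \sum_e (oracle e - p e) ^+ 2.
have D0 : 0 <= D by apply: sumr_ge0 => e _; apply: sqr_ge0.
apply: (@le_trans _ _ (Ex (fun A => 3 * D +
    (32 * r * ((G A)%:R * ((8 * r)^-1 * quadratic (zhat A) A)) +
    (16 * r * ((G A)%:R * ((8 * r)^-1 * linear (zhat A) A)) +
    n%:R ^+ 2 * (~~ G A)%:R))))).
  apply: le_network_expectation => // A.
  case: (G A) => /=; last first.
    by rewrite !mul0r !mulr0 !add0r mulr1; have := loss_le_card A; lra.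
  have := loss_le A; rewrite -/D !mul1r mulr0 addr0.
  rewrite (_ : 32 * r = 4 * (8 * r)); last by ring.
  rewrite (_ : 16 * r = 2 * (8 * r)); last by ring.
  by rewrite -[4 * _ * _]mulrA -[2 * _ * _]mulrA !mulVKf ?gt_eqF// addrA.
rewrite !network_expectationD !network_expectationZ network_expectation_cst.
rewrite -addrA lerD2l addrA lerD2r.
have := ler_wpM2l (ltW r0) quad; have := ler_wpM2l (ltW r0) lin.
lra.
Qed.

End oracle_inequality.

(** Since the logarithms are at least [1 / 2], the right side is at least
    [4 / (n0 * n)]. On the left, [2 * n0 <= n] makes [u = n0 / n] at most [1 / 2], and
    the powers of [1 / 2] absorb both factors [n0] in [n0 * n = n0 ^+ 2 / u]. *)
Lemma rare_event_cost (R : realType) (n k n0 : nat) :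
  (2 <= k)%N -> (2 <= n0)%N -> (k * n0 <= n)%N ->
  2 * (n0%:R / n%:R) ^+ (2 * n0) <=
  16 * (ln (n%:R / n0%:R) / n0%:R *
        (ln k%:R / n%:R + k%:R ^+ 2 / n%:R ^+ 2)) :> R.
Proof.
move=> k2 n02 kn.
have n2 : (2 * n0 <= n)%N by apply: leq_trans kn; rewrite leq_mul2r k2 orbT.
have n0p : 0 < n0%:R :> R by rewrite ltr0n; lia.
have np : 0 < n%:R :> R by rewrite ltr0n; lia.
have n2R : 2 * n0%:R <= n%:R :> R by rewrite -natrM ler_nat.
have Lk : 1 / 2 <= ln k%:R :> R by apply: ln_ge_half; rewrite (ler_nat _ 2).
have Ln : 1 / 2 <= ln (n%:R / n0%:R) :> R.
  by apply: ln_ge_half; rewrite ler_pdivlMr.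
set u := n0%:R / n%:R.
have u0 : 0 <= u by rewrite divr_ge0.
have u2 : u <= 1 / 2 by rewrite ler_pdivrMr//; lra.
have nu : n%:R * u = n0%:R by rewrite mulrC divfK// gt_eqF.
have pow : n0%:R * n%:R * u ^+ (2 * n0) <= 1.
  rewrite (_ : _ * _ = (n0%:R * u ^+ n0) * (n0%:R * u ^+ n0.-1)); last first.
    rewrite -[in X in _ = _ * (X * _)]nu (_ : 2 * n0 = n0 + (n0.-1 + 1))%N; last lia.
    by rewrite !exprD expr1; ring.
  have small (i : nat) : (n0 <= 2 ^ i)%N -> n0%:R * u ^+ i <= 1.
    move=> n0i; apply: (@le_trans _ _ (2 ^+ i * u ^+ i)).
      by rewrite ler_wpM2r ?exprn_ge0// -natrX ler_nat.
    by rewrite -exprMn exprn_ile1//; lra.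
  apply: mulr_ile1; rewrite ?mulr_ge0 ?exprn_ge0//; apply: small.
    exact/ltnW/ltn_expl.
  have n0E : n0 = n0.-1.+1 by clear -n02; lia.
  by rewrite [leqLHS]n0E; apply: ltn_expl.
have rate : 1 / 4 / (n0%:R * n%:R) <=
    ln (n%:R / n0%:R) / n0%:R * (ln k%:R / n%:R + k%:R ^+ 2 / n%:R ^+ 2) :> R.
  have -> : 1 / 4 / (n0%:R * n%:R) = (1 / 2 / n0%:R) * (1 / 2 / n%:R) :> R.
    by field; rewrite !gt_eqF.
  apply: ler_pM; rewrite ?divr_ge0//.
    by rewrite ler_wpM2r// invr_ge0.
  apply: (@le_trans _ _ (ln k%:R / n%:R)).
    by rewrite ler_wpM2r// invr_ge0.
  by rewrite lerDl divr_ge0 ?sqr_ge0.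
apply: le_trans (ler_wpM2l _ rate) => //.
rewrite (_ : 16 * _ = 4 / (n0%:R * n%:R)); last by field; rewrite !gt_eqF.
rewrite ler_pdivlMr ?mulr_gt0//.
by lra.
Qed.

Theorem proposition2p1 (R : realType) :
  exists C1 C2 C3 : R, [/\ 0 < C1, 0 < C2, 0 < C3 &
    forall (n k n0 : nat),
      (2 <= k <= n)%N -> (2 <= n0 <= n)%N ->
      (exists z : label_map n k, z \in balanced_maps n k n0) ->
    forall (Theta0 Thetas : 'M[R]_n),
      probability_matrix Theta0 ->
      best_block_approximation k n0 Theta0 Thetas ->
    forall (Qhat : network n -> 'M[R]_k) (zhat : network n -> label_map n k),
      (forall A : network n, least_squares_minimizer n0 A (Qhat A) (zhat A)) ->
    network_expectation Theta0 (fun A =>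
        n%:R ^- 2 *
        frobenius_norm (block_matrix (Qhat A) (zhat A) - Theta0) ^+ 2) <=
    C1 / n%:R ^+ 2 * frobenius_norm (Theta0 - Thetas) ^+ 2
    + C2 * `|Theta0| * (ln k%:R / n%:R + k%:R ^+ 2 / n%:R ^+ 2)
    + C3 * ln (n%:R / n0%:R) / n0%:R
        * (ln k%:R / n%:R + k%:R ^+ 2 / n%:R ^+ 2)].
Proof.
exists 3, 1920, 15376; split; [lra | lra | lra |].
move=> n k n0 /andP[k2 kn] /andP[n02 n0n] _.
move=> Theta Thetas [Tsym T01 T0] [[z0 [Q0 [z0bal Q0sym ->]]] _] Qhat zhat hatP.
have kn0 := balanced_maps_leq z0bal.
have n2 : (2 * n0 <= n)%N by apply: leq_trans kn0; rewrite leq_mul2r k2 orbT.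
have n0p : 0 < n0%:R :> R by rewrite ltr0n; lia.
have np : 0 < n%:R :> R by rewrite ltr0n; lia.
have n2R : 2 * n0%:R <= n%:R :> R by rewrite -natrM ler_nat.
have p01 e : 0 <= edge_prob Theta e <= 1 by apply: T01.
have prho e : edge_prob Theta e <= `|Theta| by apply: le_mx_norm.
have rho0 : 0 <= `|Theta| by apply: normr_ge0.
have Lk : 1 / 2 <= ln k%:R :> R by apply: ln_ge_half; rewrite (ler_nat _ 2).
have Ln : 1 / 2 <= ln (n%:R / n0%:R) :> R.
  by apply: ln_ge_half; rewrite ler_pdivlMr.
have rare := rare_event_cost R k2 n02 kn0.
(* The logarithm in [r] is written with [u <= 1 / 2], whose powers are the weights of the
   union bound. *)
pose u : R := n0%:R / n%:R.
have u0 : 0 < u by rewrite divr_gt0.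
have u2 : u <= 1 / 2 by rewrite ler_pdivrMr//; lra.
have nu : n%:R * u = n0%:R by rewrite mulrC divfK// gt_eqF.
have lnu : ln u = - ln (n%:R / n0%:R) by rewrite /u -invf_div lnV// posrE divr_gt0.
pose r := 4 * `|Theta| - 32 * ln u / n0%:R.
have rE : r = 4 * `|Theta| + 32 * (ln (n%:R / n0%:R) / n0%:R).
  by rewrite /r lnu mulrN mulNr opprK mulrA.
have L0 : 0 < ln (n%:R / n0%:R) / n0%:R :> R by rewrite divr_gt0//; lra.
have r0 : 0 < r by rewrite rE; lra.
have rhor : 4 * `|Theta| <= r by rewrite rE; lra.
have fail := bounded_density_fail p01 prho n02 u0 u2 nu erefl rho0.
have main := expected_loss_le p01 prho rho0 r0 rhor z0bal hatP (ltnW k2).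
have frobE A : frobenius_norm (block_matrix (Qhat A) (zhat A) - Theta) ^+ 2 =
    2 * \sum_(e : edge n) (Qhat A (zhat A (val e).1) (zhat A (val e).2)
                           - edge_prob Theta e) ^+ 2.
  have [Qsym _ _] := hatP A.
  rewrite frobenius_norm_sqr; last 2 first.
  - by rewrite linearB/= block_matrix_sym// Tsym.
  - by move=> i; rewrite !mxE eqxx T0 subrr.
  congr (_ * _); apply: eq_bigr => e _.
  by rewrite [in LHS]mxE block_matrix_edge mxE.
(* The oracle takes the averages of [Theta] over the blocks of [z0] rather than the values
   [Q0]: they are closer to [Theta] and lie between 0 and its supremum norm. *)
have approx : 2 * \sum_e (block_average (block_of z0) (edge_prob Theta)
      (block_of z0 e) - edge_prob Theta e) ^+ 2 <=
    frobenius_norm (Theta - block_matrix Q0 z0) ^+ 2.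
  rewrite frobenius_norm_sqr; last 2 first.
  - by rewrite linearB/= block_matrix_sym// Tsym.
  - by move=> i; rewrite !mxE eqxx T0 subrr.
  rewrite ler_wpM2l//.
  have best := block_average_best (block_of z0) (edge_prob Theta)
    (fun c => Q0 c.1 c.2).
  apply: le_trans (le_trans _ best) _; apply: ler_sum => e _.
    by rewrite -sqrrN opprB.
  by rewrite block_key_value// [in leRHS]mxE [(- block_matrix _ _) _ _]mxE block_matrix_edge.
under [X in network_expectation _ X]funext => A do rewrite frobE mulrA.
rewrite network_expectationZ.
move: main approx fail rare.
rewrite -/u.
set X := network_expectation _ _; set F := network_expectation _ _.
set D := \sum_e _; set Y := frobenius_norm _ ^+ 2.
set U := u ^+ _; set rate := _ / _ + _ => main approx fail rare.
have rateE : n%:R * ln k%:R + k%:R ^+ 2 = n%:R ^+ 2 * rate.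
  by rewrite /rate; field; rewrite gt_eqF.
have k1 : 1 <= k%:R ^+ 2 :> R by rewrite exprn_ege1// ler1n ltnW.
have nk : 0 <= n%:R * ln k%:R :> R by rewrite mulr_ge0//; lra.
have main' : X <= 3 * D + n%:R ^+ 2 * (240 * (r * rate)) + n%:R ^+ 2 * U.
  apply: le_trans main _; apply: lerD; last by rewrite ler_wpM2l ?sqr_ge0.
  rewrite lerD2l.
  have -> : n%:R ^+ 2 * (240 * (r * rate)) = 48 * r * (5 * (n%:R ^+ 2 * rate)) by ring.
  by rewrite ler_wpM2l ?mulr_ge0// ?(ltW r0)// -rateE; lra.
have n2p : 0 < n%:R ^+ 2 :> R by rewrite exprn_gt0.
apply: (@le_trans _ _ (3 / n%:R ^+ 2 * Y + 480 * (r * rate) + 2 * U)).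
  rewrite [leLHS](_ : _ = 2 * X / n%:R ^+ 2); last by field; rewrite gt_eqF.
  rewrite ler_pdivrMr//.
  have -> : (3 / n%:R ^+ 2 * Y + 480 * (r * rate) + 2 * U) * n%:R ^+ 2 =
     3 * Y + n%:R ^+ 2 * (480 * (r * rate)) + 2 * (n%:R ^+ 2 * U).
    by field; rewrite gt_eqF.
  lra.
rewrite -addrA -[leRHS]addrA lerD2l rE.
rewrite -[15376 * _ / _]mulrA.
move: (ln _ / _) rare => L rare; lra.
Qed.
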